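(* Let $G=(V,E)$ be a finite simple graph with girth at least $5$, let $q$ be a positive integer, and let $\mu$ be a conditionally independent probability distribution on $[q]^V$ (with respect to $G$) whose Glauber dynamics is irreducible. Suppose that parameters $0\leq\eta_v<1$ ($v\in V$) satisfy the following conditions: (i) for every $v\in V$ and every feasible pinning $\tau\in[q]^{V\setminus N[v]}$, the weighted continuous-time Glauber dynamics for $\mu^\tau_{N[v]}$ with parameter $\eta_v$ has spectral gap at least $(1-\eta_v)/2$; (ii) there exists $\epsilon>0$ such that $\sum_{u\in N(v)}\eta_u\leq1-\epsilon$ for every $v\in V$. Then the continuous-time Glauber dynamics for $\mu$ has spectral gap at least $\epsilon/2$.
   Context: The girth is the length of the shortest cycle ($\infty$ for a forest); $N(v)$ is the neighborhood of $v$ and $N[v]=N(v)\cup\{v\}$. Let $X\sim\mu$. The distribution $\mu$ is conditionally independent (with respect to $G$) if $X_u$ and $X_v$ are conditionally independent given $X_{V\setminus\{u,v\}}$ whenever $\mathrm{dist}_G(u,v)\geq2$. A pinning $\tau\in[q]^{V\setminus N[v]}$ is feasible if $\Pr_\mu[X_{V\setminus N[v]}=\tau]>0$, and then $\mu^\tau_{N[v]}$ is the conditional law of $X_{N[v]}$ given $X_{V\setminus N[v]}=\tau$. For a distribution $\nu$ on $[q]^U$ ($U$ a finite set) with support $\Omega$, and $u\in U$, define on $L^2(\nu)$ (functions on $\Omega$ with $\langle f,g\rangle_\nu=\sum_x\nu(x)f(x)g(x)$) the heat-bath projection $(P_uf)(x)=\mathbb E_\nu[f(X)\mid X_{U\setminus\{u\}}=x_{U\setminus\{u\}}]$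 and the single-site Laplacian $\mathcal L_u=\mathrm{Id}-P_u$; for $S\subseteq U$ put $\mathcal L_S=\sum_{u\in S}\mathcal L_u$. The continuous-time Glauber dynamics for $\nu$ has Laplacian $\mathcal L_U$; the Glauber dynamics is irreducible if the kernel of $\mathcal L_U$ consists only of constant functions. For a distribution $\nu$ on $[q]^{N[v]}$ and $0\leq\eta_v<1$, the weighted continuous-time Glauber dynamics with parameter $\eta_v$ has Laplacian $\mathcal L_v+\frac{1+\eta_v}{2}\mathcal L_{N(v)}$, with single-site Laplacians formed with respect to $\nu$. A dynamics with Laplacian $\mathcal M$ on $L^2(\nu)$ has spectral gap at least $\gamma$ if $\gamma\langle f,f\rangle_\nu\leq\langle f,\mathcal Mf\rangle_\nu$ for all $f$ with $\mathbb E_\nu f=0$. *)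

(* Defs.v *)
From HB Require Import structures.
From mathcomp Require Import all_boot all_order all_algebra.
From mathcomp Require Import all_classical all_reals ereal.
Set Implicit Arguments.
Unset Strict Implicit.
Unset Printing Implicit Defensive.
Import Order.TTheory GRing.Theory Num.Theory.
Local Open Scope ring_scope.

(** Finite simple graphs are symmetric irreflexive relations on a finType. *)
Section Graph.
Variables (V : finType) (e : rel V).

Definition nbh (v : V) : {set V} := [set u | e v u].
Definition cnbh (v : V) : {set V} := v |: nbh v.

Lemma mem_cnbh v : v \in cnbh v.
Proof. exact: setU11. Qed.

(** The bound [2 < size c] excludes the degenerate [ucycle]s: the empty
    sequence, and an edge traversed back and forth. *)
Definition is_cycle (c : seq V) : Prop := (2 < size c)%N /\ ucycle e c.

(** Extended-real infima, so that the girth of a forest and the distance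
    between different connected components are [+oo]. *)
Definition girth (R : realType) : \bar R :=
  ereal_inf [set ((size c)%:R)%:E | c in is_cycle]%classic.

Definition dist (R : realType) (u v : V) : \bar R :=
  ereal_inf
    [set ((size p)%:R)%:E | p in [set p | path e u p /\ last u p = v]]%classic.

End Graph.

Section Probability.
Variables (R : realType) (T : finType).
Implicit Types (mu : T -> R) (A B : pred T).

Definition is_distr mu : Prop := (forall x, 0 <= mu x) /\ \sum_x mu x = 1.

Definition Pr mu A : R := \sum_(x | A x) mu x.

Definition condPr mu A B : R := Pr mu (predI A B) / Pr mu B.

End Probability.

(** [[q]^U], with [[q]] encoded as ['I_q]; for [S : {set U}], [[q]^S] is
    [config {u | u \in S} q]. *)
Notation config U q := {ffun U -> 'I_q}.

Definition restr (U : finType) (q : nat) (S : {set U}) (x : config U q) :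
  config {u | u \in S} q := [ffun u => x (val u)].

Definition pinned (U : finType) (q : nat) (S : {set U})
    (tau : config {u | u \in S} q) : pred (config U q) :=
  [pred x | restr S x == tau].

Definition cond_indep (R : realType) (V : finType) (e : rel V) (q : nat)
    (mu : config V q -> R) : Prop :=
  forall u v : V, (2%:E <= dist e R u v)%E ->
  forall tau : config {w | w \in ~: [set u; v]} q, 0 < Pr mu (pinned tau) ->
  forall a b : 'I_q,
    condPr mu [pred x : config V q | (x u == a) && (x v == b)] (pinned tau) =
    condPr mu [pred x : config V q | x u == a] (pinned tau) *
    condPr mu [pred x : config V q | x v == b] (pinned tau).

Section LocalLaw.
Variables (R : realType) (V : finType) (e : rel V) (q : nat).
Variables (mu : config V q -> R) (v : V).

Definition feasible (tau : config {u | u \in ~: cnbh e v} q) : Prop :=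
  0 < Pr mu (pinned tau).

Definition local_law (tau : config {u | u \in ~: cnbh e v} q) :
    config {u | u \in cnbh e v} q -> R :=
  fun y => condPr mu (pinned y) (pinned tau).

End LocalLaw.

Section Glauber.
Variables (R : realType) (U : finType) (q : nat) (nu : config U q -> R).

Definition supp : finType := {x : config U q | 0 < nu x}.
Notation L2 := {ffun supp -> R}.

Definition expect (f : L2) : R := \sum_x nu (val x) * f x.

Definition inner (f g : L2) : R := \sum_x nu (val x) * f x * g x.

(** The denominator is positive whenever [A] is inhabited, since [supp] only
    contains points of positive mass. *)
Definition condE (f : L2) (A : pred supp) : R :=
  (\sum_(y | A y) nu (val y) * f y) / \sum_(y | A y) nu (val y).

Definition heat_bath (u : U) (f : L2) : L2 :=
  [ffun x => condE f [pred y | pinned (restr [set~ u] (val x)) (val y)]].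

Definition site_lap (u : U) (f : L2) : L2 := f - heat_bath u f.

Definition lap (S : {set U}) (f : L2) : L2 := \sum_(u in S) site_lap u f.

Definition glauber_lap : L2 -> L2 := lap [set: U].

Definition irreducible : Prop :=
  forall f : L2, glauber_lap f = 0 -> exists c : R, forall x, f x = c.

Definition spectral_gap_ge (M : L2 -> L2) (gamma : R) : Prop :=
  forall f : L2, expect f = 0 -> gamma * inner f f <= inner f (M f).

End Glauber.
Arguments glauber_lap {R U q} nu f.

Section WeightedGlauber.
Variables (R : realType) (V : finType) (e : rel V) (q : nat) (v : V).

Definition center : {u | u \in cnbh e v} := exist _ v (mem_cnbh e v).

Definition outer : {set {u | u \in cnbh e v}} := [set u | val u \in nbh e v].

Definition weighted_lap (nu : config {u | u \in cnbh e v} q -> R) (eta : R)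
    (f : {ffun supp nu -> R}) : {ffun supp nu -> R} :=
  [ffun x => site_lap center f x + (1 + eta) / 2 * lap outer f x].

End WeightedGlauber.
Arguments weighted_lap {R V e q v} nu eta f.

(* Main.v *)
Require Import Defs.
From HB Require Import structures.
From mathcomp Require Import all_boot all_order all_algebra.
From mathcomp Require Import all_classical all_reals ereal.
From mathcomp Require Import ring lra.
Set Implicit Arguments.
Unset Strict Implicit.
Unset Printing Implicit Defensive.
Import Order.TTheory GRing.Theory Num.Theory.
Local Open Scope ring_scope.

(* Write [g_u = L_u f].  A local gap [gamma] for the weighted dynamics [M_v]
   gives [M_v ^ 2 >= gamma M_v]; there are no triangles, so expanding the square gives
     [2 sum_(u ~ v) <g_v, g_u> >= - |g_v|^2 - eta_v sum_(u ~ v) |g_u|^2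
                                  - sum_(u <> w in N(v)) <g_u, g_w>].
   Non-adjacent sites have commuting projections, hence [<g_u, g_w> >= 0], and
   without 4-cycles each such pair occurs for at most one [v].  Summing over [v]
   bounds [|L f|^2 = sum_(u, w) <g_u, g_w>] below by [eps / 2 <f, L f>], and
   irreducibility turns [L ^ 2 >= (eps / 2) L] into a spectral gap. *)

(** * Self-adjointness, idempotence and commutation of the single-site operators *)

Section HeatBath.
Variables (R : realType) (U : finType) (q : nat) (nu : config U q -> R).
Notation L2 := {ffun supp nu -> R}.
Implicit Types (f g h : L2) (u : U) (x y : supp nu) (S : {set U}).

Lemma innerC f g : inner f g = inner g f.
Proof. by apply: eq_bigr => x _; rewrite mulrAC. Qed.

Lemma innerDl f g h : inner (f + g) h = inner f h + inner g h.
Proof.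
by rewrite -big_split; apply: eq_bigr => x _; rewrite ffunE mulrDr mulrDl.
Qed.

Lemma innerNl f g : inner (- f) g = - inner f g.
Proof. by rewrite -sumrN; apply: eq_bigr => x _; rewrite ffunE mulrN mulNr. Qed.

Lemma innerBl f g h : inner (f - g) h = inner f h - inner g h.
Proof. by rewrite innerDl innerNl. Qed.

Lemma innerBr f g h : inner h (f - g) = inner h f - inner h g.
Proof. by rewrite !(innerC h) innerBl. Qed.

Lemma inner0l f : inner 0 f = 0.
Proof. by rewrite -[X in inner X f](subrr f) innerBl subrr. Qed.

Lemma inner_suml (I : Type) (r : seq I) (P : pred I) (F : I -> L2) g :
  inner (\sum_(i <- r | P i) F i) g = \sum_(i <- r | P i) inner (F i) g.
Proof.
elim/big_rec2: _ => [|i a b _ <-]; last by rewrite innerDl.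
exact: inner0l.
Qed.

Lemma inner_sumr (I : Type) (r : seq I) (P : pred I) (F : I -> L2) g :
  inner g (\sum_(i <- r | P i) F i) = \sum_(i <- r | P i) inner g (F i).
Proof. by rewrite innerC inner_suml; apply: eq_bigr => i _; rewrite innerC. Qed.

(** The combination is spelled pointwise, which is the shape in which [weighted_lap] is defined. *)
Lemma innerDMl c f g h :
  inner ([ffun x => f x + c * g x] : L2) h = inner f h + c * inner g h.
Proof.
rewrite /inner mulr_sumr -big_split; apply: eq_bigr => x _.
by rewrite ffunE /=; ring.
Qed.

Lemma innerDMr c f g h :
  inner h ([ffun x => f x + c * g x] : L2) = inner h f + c * inner h g.
Proof. by rewrite innerC innerDMl !(innerC h). Qed.

Lemma inner_ge0 f : 0 <= inner f f.
Proof.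
apply: sumr_ge0 => x _; rewrite -mulrA mulr_ge0 ?(ltW (valP x)) //.
by rewrite -expr2 sqr_ge0.
Qed.

(** Spelled as the predicate inside [heat_bath], so that [heat_bathE] holds by unfolding; its
    classes are the fibres over which [heat_bath u] averages. *)
Definition off_site u x y : bool := pinned (restr [set~ u] (val x)) (val y).

Lemma off_site_eq u x y :
  off_site u x y = (restr [set~ u] (val y) == restr [set~ u] (val x)).
Proof. by []. Qed.

Lemma off_site_sym u : symmetric (off_site u).
Proof. by move=> x y; rewrite !off_site_eq eq_sym. Qed.

Lemma off_site_refl u : reflexive (off_site u).
Proof. by move=> x; rewrite off_site_eq. Qed.

Lemma off_site_congr u x y : off_site u x y -> off_site u x =1 off_site u y.
Proof. by rewrite off_site_eq => /eqP xy z; rewrite !off_site_eq xy. Qed.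

Definition fiber_mass u x : R := \sum_(y | off_site u x y) nu (val y).

Lemma heat_bathE u f x :
  heat_bath u f x =
  (\sum_(y | off_site u x y) nu (val y) * f y) / fiber_mass u x.
Proof. by rewrite ffunE. Qed.

Lemma fiber_mass_gt0 u x : 0 < fiber_mass u x.
Proof.
rewrite /fiber_mass (bigD1 x) ?off_site_refl //=.
by rewrite ltr_pwDl ?(valP x) // sumr_ge0 // => y _; rewrite ltW ?(valP y).
Qed.

Lemma fiber_mass_congr u x y :
  off_site u x y -> fiber_mass u x = fiber_mass u y.
Proof. by move=> xy; apply: eq_bigl; apply: off_site_congr. Qed.

Lemma heat_bath_congr u f x y :
  off_site u x y -> heat_bath u f x = heat_bath u f y.
Proof.
move=> xy; rewrite !heat_bathE (fiber_mass_congr xy); congr (_ / _).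
by apply: eq_bigl; apply: off_site_congr.
Qed.

Lemma heat_bath_fixed u f :
  (forall x y, off_site u x y -> f x = f y) -> heat_bath u f = f.
Proof.
move=> fP; apply/ffunP => x; rewrite heat_bathE.
rewrite (eq_bigr (fun y => nu (val y) * f x)); last by move=> y /fP ->.
by rewrite -mulr_suml mulrAC divff ?mul1r // gt_eqF ?fiber_mass_gt0.
Qed.

Lemma heat_bathK u f : heat_bath u (heat_bath u f) = heat_bath u f.
Proof. by apply: heat_bath_fixed => x y; apply: heat_bath_congr. Qed.

(** The kernel [nu x * nu y / fiber_mass u x] is symmetric, because [fiber_mass u] is constant on
    each class of [off_site u]. *)
Lemma heat_bath_sa u f g : inner (heat_bath u f) g = inner f (heat_bath u g).
Proof.
have E h k : inner (heat_bath u h) k =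
    \sum_x \sum_(y | off_site u x y)
      nu (val x) * nu (val y) * h y * k x / fiber_mass u x.
  apply: eq_bigr => x _; rewrite heat_bathE mulrA mulrAC mulr_sumr !mulr_suml.
  by apply: eq_bigr => y _; ring.
rewrite (innerC f) !E (exchange_big_dep predT) //=; apply: eq_bigr => x _.
rewrite (eq_bigl (off_site u x)); last by move=> y; rewrite off_site_sym.
by apply: eq_bigr => y xy; rewrite (fiber_mass_congr xy); ring.
Qed.

Lemma heat_bathD u f g : heat_bath u (f + g) = heat_bath u f + heat_bath u g.
Proof.
apply/ffunP => x; rewrite [RHS]ffunE !heat_bathE -mulrDl -big_split /=.
by congr (_ / _); apply: eq_bigr => y _; rewrite ffunE mulrDr.
Qed.

Lemma heat_bathN u f : heat_bath u (- f) = - heat_bath u f.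
Proof.
apply/ffunP => x; rewrite [RHS]ffunE !heat_bathE -mulNr -sumrN.
by congr (_ / _); apply: eq_bigr => y _; rewrite ffunE mulrN.
Qed.

Lemma heat_bathM u c f :
  heat_bath u ([ffun x => c * f x] : L2) = [ffun x => c * heat_bath u f x].
Proof.
apply/ffunP => x; rewrite [RHS]ffunE !heat_bathE mulrA mulr_sumr.
by congr (_ / _); apply: eq_bigr => y _; rewrite ffunE mulrCA.
Qed.

Lemma site_lapD u f g : site_lap u (f + g) = site_lap u f + site_lap u g.
Proof. by rewrite /site_lap heat_bathD opprD addrACA. Qed.

Lemma site_lapN u f : site_lap u (- f) = - site_lap u f.
Proof. by rewrite /site_lap heat_bathN opprD. Qed.

Lemma site_lapB u f g : site_lap u (f - g) = site_lap u f - site_lap u g.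
Proof. by rewrite site_lapD site_lapN. Qed.

Lemma site_lapE u f x : site_lap u f x = f x - heat_bath u f x.
Proof. by rewrite [LHS]ffunE; congr (_ + _); rewrite [LHS]ffunE. Qed.

Lemma site_lapM u c f :
  site_lap u ([ffun x => c * f x] : L2) = [ffun x => c * site_lap u f x].
Proof.
by apply/ffunP => x; rewrite [RHS]ffunE !site_lapE heat_bathM !ffunE mulrBr.
Qed.

Lemma site_lapK u f : site_lap u (site_lap u f) = site_lap u f.
Proof.
by rewrite {1}/site_lap heat_bathD heat_bathN heat_bathK subrr subr0.
Qed.

Lemma site_lap_sa u f g : inner (site_lap u f) g = inner f (site_lap u g).
Proof. by rewrite innerBl innerBr heat_bath_sa. Qed.

Lemma site_lap_cst u (c : R) : site_lap u ([ffun=> c] : L2) = 0.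
Proof.
by rewrite /site_lap heat_bath_fixed ?subrr // => x y _; rewrite !ffunE.
Qed.

Lemma site_lap_comm u w f :
  heat_bath u (heat_bath w f) = heat_bath w (heat_bath u f) ->
  site_lap u (site_lap w f) = site_lap w (site_lap u f).
Proof.
move=> C; rewrite /site_lap !heat_bathD !heat_bathN C !opprD !opprK.
by rewrite -!addrA; congr (_ + _); rewrite addrCA.
Qed.

(** The product of two commuting orthogonal projections is again one, so the inner product equals
    [|L_u L_w f|^2]. *)
Lemma inner_site_lap_comm_ge0 u w f :
  (forall g, heat_bath u (heat_bath w g) = heat_bath w (heat_bath u g)) ->
  0 <= inner (site_lap u f) (site_lap w f).
Proof.
move=> C; suff -> : inner (site_lap u f) (site_lap w f) =
    inner (site_lap u (site_lap w f)) (site_lap u (site_lap w f)).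
  exact: inner_ge0.
rewrite [RHS]site_lap_sa site_lapK site_lap_comm // [RHS]site_lap_sa site_lapK.
by rewrite -site_lap_sa innerC.
Qed.

Lemma lapD S f g : lap S (f + g) = lap S f + lap S g.
Proof. by rewrite -big_split; apply: eq_bigr => u _; rewrite site_lapD. Qed.

Lemma lapN S f : lap S (- f) = - lap S f.
Proof. by rewrite -sumrN; apply: eq_bigr => u _; rewrite site_lapN. Qed.

Lemma lapB S f g : lap S (f - g) = lap S f - lap S g.
Proof. by rewrite lapD lapN. Qed.

Lemma lapM S c f : lap S ([ffun x => c * f x] : L2) = [ffun x => c * lap S f x].
Proof.
apply/ffunP => x; rewrite [RHS]ffunE !sum_ffunE mulr_sumr.
by apply: eq_bigr => u _; rewrite site_lapM ffunE.
Qed.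

Lemma lap_sa S f g : inner (lap S f) g = inner f (lap S g).
Proof.
by rewrite inner_suml inner_sumr; apply: eq_bigr => u _; rewrite site_lap_sa.
Qed.

Lemma lap_cst S (c : R) : lap S ([ffun=> c] : L2) = 0.
Proof. by apply: big1 => u _; rewrite site_lap_cst. Qed.

Lemma inner_lap_ge0 S f : 0 <= inner f (lap S f).
Proof.
rewrite inner_sumr; apply: sumr_ge0 => u _.
by rewrite -site_lapK -site_lap_sa inner_ge0.
Qed.

Lemma expect_inner f : expect f = inner f [ffun=> 1].
Proof. by apply: eq_bigr => x _; rewrite ffunE mulr1. Qed.

End HeatBath.

(** * Spectral gaps and operator inequalities of the form [M ^ 2 >= gamma M] *)

Section SpectralGap.
Variables (R : realType) (U : finType) (q : nat) (nu : config U q -> R).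
Notation L2 := {ffun supp nu -> R}.

Lemma inner_sub_scale (c : R) (f g h k : L2) :
  inner (f - [ffun x => c * g x]) (h - [ffun x => c * k x]) =
  inner f h - c * inner g h - c * inner f k + c ^+ 2 * inner g k.
Proof.
have E (a b : L2) : a - [ffun x => c * b x] = [ffun x => a x + (- c) * b x].
  by apply/ffunP => x; rewrite !ffunE mulNr.
by rewrite !E !innerDMl !innerDMr; ring.
Qed.

Section SquareFromGap.
Variables (M : L2 -> L2) (gamma : R).
Hypotheses (M_sa : forall f g, inner (M f) g = inner f (M g))
  (MB : forall f g, M (f - g) = M f - M g)
  (M_cst : forall c : R, M [ffun=> c] = 0).

(* For mean-zero [h], expand [0 <= |M h - gamma h|^2]. *)
Lemma square_ge_of_gap : is_distr nu -> 0 <= gamma ->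
  spectral_gap_ge M gamma ->
  forall f, gamma * inner f (M f) <= inner (M f) (M f).
Proof.
move=> [nu_ge0 nu1] gamma_ge0 gap f; pose c := expect f.
have E1 : expect ([ffun=> 1] : L2) = 1.
  rewrite -[RHS]nu1 [RHS](bigID (fun x => 0 < nu x)) /= [X in _ + X]big1 ?addr0.
    by rewrite big_sub; apply: eq_bigr => x _; rewrite ffunE mulr1.
  by move=> x; rewrite -leNgt => x_le0; apply/eqP; rewrite eq_le x_le0 nu_ge0.
pose h : L2 := f - [ffun=> c].
have h0 : expect h = 0.
  rewrite expect_inner innerBl -expect_inner -/c.
  suff -> : inner ([ffun=> c] : L2) [ffun=> 1] = c * expect ([ffun=> 1] : L2).
    by rewrite E1 mulr1 subrr.
  by rewrite mulr_sumr; apply: eq_bigr => x _; rewrite !ffunE; ring.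
have Mh : M h = M f by rewrite MB M_cst subr0.
(* Removing the mean of [f] leaves the form unchanged, since the self-adjoint [M] kills
   constants. *)
have hMf : inner h (M f) = inner f (M f).
  by rewrite innerBl -[X in _ - X]M_sa M_cst inner0l subr0.
have := inner_ge0 (M h - [ffun x => gamma * h x]).
rewrite inner_sub_scale Mh (innerC (M f) h) hMf => ge0.
(* Scaled by [gamma], the gap bounds [gamma ^ 2 * |h|^2] by [gamma * <f, M f>], which absorbs half
   of the cross term. *)
have := ler_wpM2l gamma_ge0 (gap h h0); rewrite Mh hMf => gap'.
rewrite -subr_ge0; apply: le_trans ge0 _; rewrite -subr_ge0.
by move: gap'; rewrite -subr_ge0 expr2; congr (0 <= _); ring.
Qed.

End SquareFromGap.

(** The codomain [R^o] turns the function space into a vector space over [R], to which rank-nullity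
    applies. *)
Let V := {ffun supp nu -> R^o}.

Definition glauber_reg (f : V) : V := glauber_lap nu f.

Fact glauber_reg_linear : linear glauber_reg.
Proof.
move=> c f g; rewrite /glauber_reg [LHS]lapD; congr (_ + _).
have -> : c *: f = [ffun x => c * f x] by apply/ffunP => x; rewrite !ffunE.
by rewrite [LHS]lapM; apply/ffunP => x; rewrite !ffunE.
Qed.
HB.instance Definition _ :=
  GRing.isLinear.Build R V V *:%R glauber_reg glauber_reg_linear.

Definition expect_reg (f : V) : R^o := @expect R U q nu f.

Fact expect_reg_linear : linear expect_reg.
Proof.
move=> c f g; rewrite /expect_reg /expect scaler_sumr -big_split.
apply: eq_bigr => x _; rewrite !ffunE mulrDr; congr (_ + _).
exact: mulrCA.
Qed.
HB.instance Definition _ :=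
  GRing.isLinear.Build R V R^o *:%R expect_reg expect_reg_linear.

(* The image of the self-adjoint Laplacian is orthogonal to constants, and has
   codimension at most one by irreducibility. *)
Lemma glauber_lap_onto : irreducible nu -> forall f : L2, expect f = 0 ->
  exists h, f = glauber_lap nu h.
Proof.
move=> irr f f0; pose L := linfun glauber_reg; pose E := linfun expect_reg.
have LE : (limg L <= lker E)%VS.
  apply/subvP => g /memv_imgP[h _ ->]; rewrite memv_ker !lfunE /=.
  apply/eqP; rewrite /expect_reg expect_inner [LHS]lap_sa lap_cst.
  by rewrite innerC inner0l.
(* Irreducibility makes the kernel at most a line, and the expectation is nonzero unless the support
   is empty, in which case the whole space is trivial. *)
have dimL : (\dim (lker L) <= \dim (limg E))%N.
  have [x|supp0] := pickP (mem (supp nu)).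
    move=> _; apply: (@leq_trans 1).
      have : (lker L <= <[([ffun=> 1] : V)]>)%VS.
        apply/subvP => g; rewrite memv_ker lfunE => /eqP/irr[c gc].
        apply/vlineP; exists c; apply/ffunP => y.
        by rewrite gc !ffunE [RHS]mulr1.
      by move/dimvS/leq_trans; apply; rewrite dim_vline; case: (_ == _).
    rewrite lt0n dimv_eq0; apply/eqP => E0.
    have : E [ffun=> 1] \in limg E by rewrite memv_img ?memvf.
    rewrite E0 memv0 lfunE /= => /eqP; apply/eqP; rewrite gt_eqF //.
    rewrite /expect_reg /expect (bigD1 x) //= ffunE mulr1.
    rewrite ltr_pwDl ?(valP x) // sumr_ge0 // => y _.
    by rewrite ffunE mulr1 ltW ?(valP y).
  rewrite (_ : lker L = 0%VS) ?dimv0 //; apply/eqP; rewrite -subv0.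
  apply/subvP => g _; rewrite memv0; apply/eqP/ffunP => x.
  by have := supp0 x.
have : limg L == lker E.
  (* Rank-nullity for [L] and for [E] reduces the comparison of dimensions to [dimL]. *)
  rewrite eqEdim LE /= -(leq_add2r (\dim (limg E))).
  have := limg_ker_dim E fullv; rewrite capfv => ->.
  by have := limg_ker_dim L fullv; rewrite capfv => <-; rewrite addnC leq_add2l.
move/eqP => imE; have : (f : V) \in limg L.
  by rewrite imE memv_ker lfunE; apply/eqP.
by case/memv_imgP => h _ ->; exists h; rewrite lfunE.
Qed.

(* Write [f = L h] and expand [0 <= <gamma h - L h, L (gamma h - L h)>]. *)
Lemma gap_of_square_ge (gamma : R) : irreducible nu -> 0 <= gamma ->
  (forall f : L2, gamma * inner f (glauber_lap nu f) <=
     inner (glauber_lap nu f) (glauber_lap nu f)) ->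
  spectral_gap_ge (glauber_lap nu) gamma.
Proof.
move=> irr gamma_ge0 sq f /(glauber_lap_onto irr)[h ->].
set L := glauber_lap nu in sq *.
have := inner_lap_ge0 [set: U] (L h - [ffun x => gamma * h x]).
rewrite lapB lapM -/(glauber_lap nu) -/L inner_sub_scale.
rewrite -(lap_sa [set: U] h) -/(glauber_lap nu) -/L => ge0.
have gap' := ler_wpM2l gamma_ge0 (sq h).
rewrite -subr_ge0; apply: le_trans ge0 _; rewrite -subr_ge0.
by move: gap'; rewrite -subr_ge0 expr2; congr (0 <= _); ring.
Qed.

End SpectralGap.

(** * Averages rewritten over all configurations, and commuting heat baths *)

Section TotalExtension.
Variables (R : realType) (U : finType) (q : nat) (nu : config U q -> R).
Hypothesis nu_ge0 : forall x, 0 <= nu x.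
Notation L2 := {ffun supp nu -> R}.

(** The default zero is harmless in weighted sums, where the factor [nu x] vanishes off the
    support. *)
Definition ext (f : L2) (x : config U q) : R := oapp f 0 (insub x).

Lemma ext_val f (x : supp nu) : ext f (val x) = f x.
Proof. by rewrite /ext valK. Qed.

Lemma sum_supp (P : pred (config U q)) (F : config U q -> R) :
  \sum_(y : supp nu | P (val y)) nu (val y) * F (val y) =
  \sum_(x | P x) nu x * F x.
Proof.
rewrite -(big_sub_cond (fun x => 0 < nu x) P (fun x => nu x * F x)).
rewrite [RHS](bigID (fun x => 0 < nu x)) /= [X in _ = _ + X]big1 ?addr0.
  by apply: eq_bigl => x; rewrite andbC.
move=> x /andP[_]; rewrite -leNgt => x_le0.
by rewrite (_ : nu x = 0) ?mul0r //; apply/eqP; rewrite eq_le x_le0 nu_ge0.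
Qed.

Definition upd (x : config U q) (u : U) (a : 'I_q) : config U q :=
  [ffun w => if w == u then a else x w].

Lemma upd_id x u : upd x u (x u) = x.
Proof. by apply/ffunP => w; rewrite ffunE; case: eqP => [->|]. Qed.

Lemma upd_comm x u w a b : u != w -> upd (upd x u a) w b = upd (upd x w b) u a.
Proof.
move=> uw; apply/ffunP => t; rewrite !ffunE.
by case: (t =P w) => // ->; rewrite eq_sym (negPf uw).
Qed.

Lemma restr_eqP (S : {set U}) (x y : config U q) :
  reflect {in S, x =1 y} (restr S x == restr S y).
Proof.
apply: (iffP eqP) => [/ffunP xy u uS|xy].
  by have := xy (exist _ u uS); rewrite !ffunE.
by apply/ffunP => u; rewrite !ffunE xy // (valP u).
Qed.

Lemma sum_off_site u (x : config U q) (F : config U q -> R) :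
  \sum_(y | restr [set~ u] y == restr [set~ u] x) F y = \sum_a F (upd x u a).
Proof.
rewrite (reindex_onto (upd x u) (fun y => y u)) => [|y /restr_eqP xy] /=.
  apply: eq_bigl => a; rewrite ffunE !eqxx andbT; apply/restr_eqP => w.
  by rewrite !inE ffunE => /negPf ->.
apply/ffunP => w; rewrite ffunE; case: eqP => [->//|/eqP wu].
by rewrite xy // !inE.
Qed.

(** Parametrising the fibre by the spin at [u] lets both sums run over all of ['I_q], including
    updates that leave the support. *)
Lemma heat_bath_upd u f (x : supp nu) :
  heat_bath u f x =
  (\sum_a nu (upd (val x) u a) * ext f (upd (val x) u a)) /
  \sum_a nu (upd (val x) u a).
Proof.
rewrite heat_bathE; congr (_ / _).
  rewrite -(sum_off_site u (val x) (fun y => nu y * ext f y)) -sum_supp.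
  by apply: eq_bigr => y _; rewrite ext_val.
rewrite -(sum_off_site u (val x) nu) /fiber_mass.
under eq_bigr do rewrite -[nu _]mulr1.
rewrite (sum_supp (pinned (restr [set~ u] (val x))) (fun=> 1)).
by apply: eq_bigr => y _; rewrite mulr1.
Qed.

Lemma inner_ext (f g : L2) : inner f g = \sum_x nu x * (ext f x * ext g x).
Proof.
rewrite -(sum_supp predT); apply: eq_bigr => x _; rewrite !ext_val.
by rewrite mulrA.
Qed.

Lemma sum_upd_gt0 x u : 0 < nu x -> 0 < \sum_a nu (upd x u a).
Proof.
move=> x_gt0; rewrite (bigD1 (x u)) //= upd_id ltr_pwDl //.
exact: sumr_ge0.
Qed.

(** Conditional independence of the spins at [u] and [w] given all others, with denominators cleared
    so that it can be stated for every [x], even on a fibre of zero mass. *)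
Definition fiber_product u w : Prop := forall x a b,
  nu (upd (upd x u a) w b) * (\sum_a' \sum_b' nu (upd (upd x u a') w b')) =
  (\sum_b' nu (upd (upd x u a) w b')) * (\sum_a' nu (upd (upd x u a') w b)).

Lemma fiber_product_sym u w : u != w -> fiber_product u w -> fiber_product w u.
Proof.
move=> uw prod x b a; rewrite -(upd_comm _ _ _ uw) mulrC [RHS]mulrC.
have E c :
    \sum_a' nu (upd (upd x w c) u a') = \sum_a' nu (upd (upd x u a') w c).
  by apply: eq_bigr => a' _; rewrite (upd_comm _ _ _ uw).
rewrite (eq_bigr _ (fun c _ => E c)) exchange_big /= mulrC prod; congr (_ * _).
  by apply: eq_bigr => c _; rewrite (upd_comm _ _ _ uw).
by rewrite E.
Qed.

(** By independence, the law of the spin at [u] with the spin at [w] held fixed is its marginal over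
    the two-site fibre, so the iterated average is a single average over that fibre. *)
Lemma heat_bath2 u w f (x : supp nu) : u != w -> fiber_product u w ->
  heat_bath u (heat_bath w f) x =
  (\sum_a \sum_b nu (upd (upd (val x) u a) w b) *
                  ext f (upd (upd (val x) u a) w b)) /
  \sum_a \sum_b nu (upd (upd (val x) u a) w b).
Proof.
move=> uw prod; rewrite heat_bath_upd; set X := val x.
set Z := (X in _ = _ / X); set B := \sum_a nu (upd X u a).
have X_gt0 : 0 < nu X := valP x.
have B_gt0 : 0 < B := sum_upd_gt0 u X_gt0.
have Xw a : upd (upd X u a) w (X w) = upd X u a.
  by rewrite -[X in upd _ w X](_ : upd X u a w = X w) ?upd_id // ffunE eq_sym
    (negPf uw).
have E a : nu (upd X u a) * Z = (\sum_b nu (upd (upd X u a) w b)) * B.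
  rewrite -[in LHS](Xw a) prod; congr (_ * _).
  by apply: eq_bigr => a' _; rewrite Xw.
have Z_gt0 : 0 < Z.
  apply: lt_le_trans (_ : \sum_a nu (upd X u a) <= Z) => //.
  apply: ler_sum => a _; rewrite (bigD1 (X w)) //= Xw lerDl.
  exact: sumr_ge0.
rewrite (eq_bigr (fun a => B / Z * \sum_b nu (upd (upd X u a) w b) *
    ext f (upd (upd X u a) w b))).
  by rewrite -mulr_sumr mulrAC -mulrA mulrAC [RHS]mulrC; field; rewrite !gt_eqF.
(* At an update outside the support [heat_bath w f] has no value; but then [E] forces its whole
   [w]-fibre to have zero mass, so both sides vanish. *)
move=> a _; have := nu_ge0 (upd X u a); rewrite le_eqVlt => /predU1P[a0|a_gt0].
  move: (E a); rewrite -a0 mul0r => /esym/eqP.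
  rewrite mulf_eq0 (gt_eqF B_gt0) orbF.
  rewrite psumr_eq0 // => /allP A0; rewrite mul0r big1 ?mulr0 // => b _.
  by rewrite (eqP (A0 b (mem_index_enum b))) mul0r.
pose y : supp nu := exist _ (upd X u a) a_gt0.
have := ext_val (heat_bath w f) y; rewrite heat_bath_upd /= => ->.
have A_gt0 := sum_upd_gt0 w a_gt0.
have -> : nu (upd X u a) = (\sum_b nu (upd (upd X u a) w b)) * B / Z.
  by rewrite -E mulfK // gt_eqF.
by field; rewrite !gt_eqF.
Qed.

Lemma heat_bath_comm u w : u != w -> fiber_product u w ->
  forall f : L2, heat_bath u (heat_bath w f) = heat_bath w (heat_bath u f).
Proof.
move=> uw prod f; have wu : w != u by rewrite eq_sym.
apply/ffunP => x.
rewrite !heat_bath2 //; last exact: fiber_product_sym.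
by rewrite exchange_big [in X in _ = _ / X]exchange_big; congr (_ / _);
  apply: eq_bigr => b _; apply: eq_bigr => a _; rewrite (upd_comm _ _ _ uw).
Qed.

End TotalExtension.

(** * Distances, and the absence of triangles and 4-cycles *)

Section GraphDistance.
Variables (R : realType) (V : finType) (e : rel V).

Lemma dist_ge2 u w : u != w -> ~~ e u w -> (2%:E <= dist e R u w)%E.
Proof.
move=> uw euw; apply: le_ereal_inf_tmp => _ [p [+ +] <-].
case: p => [|a [|b p]] /=; first by move=> _ uw'; rewrite uw' eqxx in uw.
  by rewrite andbT => ea aw; rewrite -aw ea in euw.
by move=> _ _; rewrite lee_fin ler_nat.
Qed.

Hypothesis girth_ge5 : (5%:E <= girth e R)%E.

Lemma size_cycle_ge5 c : is_cycle e c -> (4 < size c)%N.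
Proof.
move=> cyc; rewrite -(ler_nat R) -lee_fin; apply: le_trans girth_ge5 _.
by apply: ereal_inf_lbound; exists c.
Qed.

Hypotheses (e_sym : symmetric e) (e_irr : irreflexive e).

Lemma edge_neq u w : e u w -> u != w.
Proof. by apply: contraTneq => ->; rewrite e_irr. Qed.

Lemma no_triangle u v w : e v u -> e v w -> ~~ e u w.
Proof.
move=> vu vw; apply/negP => uw.
suff /size_cycle_ge5 : is_cycle e [:: v; u; w] by [].
split=> //; rewrite /ucycle /= vu uw e_sym vw !inE negb_or.
by rewrite (edge_neq vu) (edge_neq vw) (edge_neq uw).
Qed.

(** Distinct [v] and [v'] would close the 4-cycle [v, u, v', w]. *)
Lemma common_nbh_uniq u w v v' :
  u != w -> e v u -> e v w -> e v' u -> e v' w -> v = v'.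
Proof.
move=> uw vu vw v'u v'w; apply/eqP/negPn/negP => vv'.
suff /size_cycle_ge5 : is_cycle e [:: v; u; v'; w] by [].
split=> //; rewrite /ucycle /= vu v'w (e_sym w) vw (e_sym u) v'u !inE !negb_or.
rewrite (edge_neq vu) (edge_neq vw) (edge_neq v'w) uw vv' (eq_sym u).
by rewrite (edge_neq v'u).
Qed.

End GraphDistance.

(** * Conditional independence as a product structure on two-site fibres *)

Section ConditionalIndependence.
Variables (R : realType) (V : finType) (e : rel V) (q : nat).
Variable mu : config V q -> R.
Hypotheses (mu_ge0 : forall x, 0 <= mu x) (mu_ci : cond_indep e mu).

Lemma sum_off_pair u w (x : config V q) (P : pred (config V q))
    (F : config V q -> R) : u != w ->
  \sum_(y | P y && pinned (restr (~: [set u; w]) x) y) F y =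
  \sum_(p : 'I_q * 'I_q | P (upd (upd x u p.1) w p.2))
    F (upd (upd x u p.1) w p.2).
Proof.
move=> uw; rewrite (reindex_onto
  (fun p : 'I_q * 'I_q => upd (upd x u p.1) w p.2) (fun y => (y u, y w))) => [|y /andP[_ /restr_eqP xy]] /=.
  apply: eq_bigl => -[a b] /=; rewrite !ffunE !eqxx (negPf uw) eqxx andbT.
  rewrite [X in _ && X](_ : _ = true) ?andbT //; apply/restr_eqP => t.
  by rewrite !inE negb_or !ffunE => /andP[/negPf -> /negPf ->].
apply/ffunP => t; rewrite !ffunE; case: (t =P w) => [->//|/eqP tw].
by case: (t =P u) => [->//|/eqP tu]; rewrite xy // !inE negb_or tu.
Qed.

Lemma cond_indep_fiber_product u w : u != w -> ~~ e u w -> fiber_product mu u w.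
Proof.
move=> uw euw x a b; set tau := restr (~: [set u; w]) x.
pose G (p : 'I_q * 'I_q) := mu (upd (upd x u p.1) w p.2).
have Eu p : upd (upd x u p.1) w p.2 u = p.1 by rewrite !ffunE (negPf uw) eqxx.
have Ew p : upd (upd x u p.1) w p.2 w = p.2 by rewrite !ffunE eqxx.
have Pab : Pr mu (predI [pred y : config V q | (y u == a) && (y w == b)]
    (pinned tau)) = G (a, b).
  rewrite /Pr [LHS]sum_off_pair // (big_pred1 (a, b)) // => p.
  by rewrite [LHS]/= Eu Ew; case: p.
have Pa : Pr mu (predI [pred y : config V q | y u == a] (pinned tau)) =
    \sum_b' G (a, b').
  rewrite /Pr [LHS]sum_off_pair //.
  rewrite (eq_bigl (fun p : 'I_q * 'I_q => (p.1 == a) && true)); last first.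
    by move=> p /=; rewrite Eu andbT.
  by rewrite -(pair_big (pred1 a) predT (fun a b => G (a, b))) big_pred1_eq.
have Pb : Pr mu (predI [pred y : config V q | y w == b] (pinned tau)) =
    \sum_a' G (a', b).
  rewrite /Pr [LHS]sum_off_pair //.
  rewrite (eq_bigl (fun p : 'I_q * 'I_q => p.2 == b)); last first.
    by move=> p /=; rewrite Ew.
  rewrite -(pair_big predT (pred1 b) (fun a b => G (a, b))).
  by apply: eq_bigr => a' _; rewrite big_pred1_eq.
have P1 : Pr mu (pinned tau) = \sum_a' \sum_b' G (a', b').
  rewrite /Pr (sum_off_pair x predT) //.
  by rewrite -(pair_big predT predT (fun a b => G (a, b))).
have := mu_ci (dist_ge2 R uw euw) (tau := tau).
rewrite /condPr => /(_ _ a b); rewrite Pab Pa Pb P1 => ci.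
change (G (a, b) * (\sum_a' \sum_b' G (a', b')) =
  (\sum_b' G (a, b')) * \sum_a' G (a', b)).
have G_ge0 p : 0 <= G p by apply: mu_ge0.
have : 0 <= \sum_a' \sum_b' G (a', b').
  by apply: sumr_ge0 => a' _; apply: sumr_ge0.
(* [cond_indep] speaks only of pinnings of positive mass; on a null fibre every weight is zero and
   both sides vanish. *)
rewrite le_eqVlt => /predU1P[/esym Z0|Z_gt0].
  rewrite Z0 mulr0; move/eqP: Z0; rewrite psumr_eq0 => [/allP/(_ a)|a' _].
    by rewrite mem_index_enum => /(_ isT)/eqP ->; rewrite mul0r.
  exact: sumr_ge0.
move: (ci Z_gt0) (lt0r_neq0 Z_gt0).
set Z := \sum_a' \sum_b' _; set A := \sum_b' _; set B := \sum_a' _ => ciZ Zn0.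
rewrite -[LHS](_ : G (a, b) / Z * Z ^+ 2 = _); last by field.
by rewrite ciZ; field.
Qed.

End ConditionalIndependence.

(** * Pinned neighbourhoods and localization of the weighted dynamics *)

Section Localization.
Variables (R : realType) (V : finType) (e : rel V) (q : nat).
Variables (mu : config V q -> R) (v : V).
Hypotheses (mu_ge0 : forall x, 0 <= mu x).
Notation sub := {u | u \in cnbh e v}.
Notation L2 := {ffun supp mu -> R}.

(** A pinning is represented by a full configuration [z] inducing it; [overlay z] is then a
    bijection from local configurations onto those compatible with the pinning. *)
Definition overlay (z : config V q) (y : config sub q) : config V q :=
  [ffun w => if insub w is Some s then y s else z w].

Lemma restr_overlay z y : restr (cnbh e v) (overlay z y) = y.
Proof. by apply/ffunP => s; rewrite !ffunE valK. Qed.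

Lemma overlay_restr z y x :
  (restr (~: cnbh e v) x == restr (~: cnbh e v) z) ->
  restr (cnbh e v) x = y -> overlay z y = x.
Proof.
move=> /restr_eqP xz <-; apply/ffunP => w; rewrite ffunE.
by case: insubP => [s _ <-|wN]; rewrite ?ffunE // xz // inE.
Qed.

Lemma restr_overlayC z y :
  restr (~: cnbh e v) (overlay z y) = restr (~: cnbh e v) z.
Proof.
apply/eqP/restr_eqP => w; rewrite inE ffunE => wN.
by rewrite insubN.
Qed.

Lemma overlay_upd z y u a : overlay z (upd y u a) = upd (overlay z y) (val u) a.
Proof.
apply/ffunP => w; rewrite !ffunE; case: insubP => [s sin <-|wN].
  by rewrite ffunE (inj_eq val_inj).
by case: (w =P val u) wN => // ->; rewrite (valP u).
Qed.

Lemma sum_overlay z (F : config V q -> R) :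
  \sum_(x | restr (~: cnbh e v) x == restr (~: cnbh e v) z) F x =
  \sum_y F (overlay z y).
Proof.
rewrite (reindex_onto (overlay z) (restr (cnbh e v))) => [|x xz] /=.
  by apply: eq_bigl => y; rewrite restr_overlayC restr_overlay !eqxx.
exact: overlay_restr.
Qed.

Section Pinning.
Variable z : config V q.
Let tau := restr (~: cnbh e v) z.
Hypothesis tau_feasible : feasible mu tau.
Notation nu := (local_law mu tau).

Lemma local_lawE y : nu y = mu (overlay z y) / Pr mu (pinned tau).
Proof.
rewrite /local_law /condPr; congr (_ / _).
rewrite /Pr (big_pred1 (overlay z y)) // => x /=; apply/andP/eqP.
  by case=> /eqP yx xz; rewrite (overlay_restr xz yx).
by move=> ->; rewrite /pinned /= restr_overlay restr_overlayC.
Qed.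

Lemma local_law_distr : is_distr nu.
Proof.
split=> [y|]; first by rewrite local_lawE divr_ge0 // ltW.
under eq_bigr do rewrite local_lawE.
by rewrite -mulr_suml -sum_overlay divff // gt_eqF.
Qed.

Lemma supp_overlay (y : supp nu) : 0 < mu (overlay z (val y)).
Proof. by have := valP y; rewrite local_lawE pmulr_lgt0 // invr_gt0. Qed.

Definition loc (f : L2) : {ffun supp nu -> R} :=
  [ffun y => ext f (overlay z (val y))].

Lemma ext_loc f y : nu y * ext (loc f) y = nu y * ext f (overlay z y).
Proof.
have [nu_ge0 _] := local_law_distr.
have := nu_ge0 y; rewrite le_eqVlt => /predU1P[<-|y_gt0].
  by rewrite !mul0r.
pose s : supp nu := exist _ y y_gt0.
by rewrite -[y in ext _ y]/(val s) ext_val ffunE.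
Qed.

Definition supp_lift (y : supp nu) : supp mu :=
  exist _ (overlay z (val y)) (supp_overlay y).

Lemma locE f (y : supp nu) : loc f y = f (supp_lift y).
Proof. by rewrite ffunE -ext_val. Qed.

(** Updating a site of [N[v]] never leaves the pinned set, and the normalising constant
    [Pr mu (pinned tau)] cancels in the heat-bath quotient. *)
Lemma site_lap_loc u f : site_lap u (loc f) = loc (site_lap (val u) f).
Proof.
have [nu_ge0 _] := local_law_distr.
apply/ffunP => y; rewrite [RHS]locE !site_lapE locE; congr (_ - _).
rewrite !heat_bath_upd //=.
under eq_bigr do rewrite ext_loc local_lawE overlay_upd mulrAC.
rewrite -mulr_suml; under [X in _ / X]eq_bigr do rewrite local_lawE overlay_upd.
rewrite -[X in _ / X]mulr_suml -mulf_div divff ?mulr1 //.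
by rewrite invr_eq0 gt_eqF.
Qed.

Lemma lap_loc f : lap (outer e v) (loc f) = loc (lap (nbh e v) f).
Proof.
apply/ffunP => y; rewrite [RHS]locE !sum_ffunE.
have -> : \sum_(u in nbh e v)
    site_lap u f (supp_lift y) =
  \sum_(u in cnbh e v | u \in nbh e v)
    site_lap u f (supp_lift y).
  by apply: eq_bigl => u; rewrite !inE; case: (e v u); rewrite ?orbT ?andbF.
rewrite (big_sub_cond (mem (cnbh e v)) (mem (nbh e v))
  (fun u => site_lap u f (supp_lift y))).
by apply: eq_big => u; [rewrite inE | rewrite site_lap_loc locE].
Qed.

(** The operator [M_v] on functions of the whole configuration; it only resamples sites of [N[v]],
    so it restricts to each feasible pinning. *)
Definition global_weighted_lap (eta : R) (f : L2) : L2 :=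
  [ffun x => site_lap v f x + (1 + eta) / 2 * lap (nbh e v) f x].

Lemma weighted_lap_loc eta f :
  weighted_lap nu eta (loc f) = loc (global_weighted_lap eta f).
Proof.
apply/ffunP => y; rewrite [LHS]ffunE site_lap_loc lap_loc [RHS]locE !locE.
by rewrite [RHS]ffunE.
Qed.

Lemma inner_loc f g : Pr mu (pinned tau) * inner (loc f) (loc g) =
  \sum_(x | restr (~: cnbh e v) x == tau) mu x * (ext f x * ext g x).
Proof.
have [nu_ge0 _] := local_law_distr.
rewrite sum_overlay inner_ext // mulr_sumr; apply: eq_bigr => y _.
rewrite (mulrA (nu y)) ext_loc mulrAC ext_loc local_lawE.
by field; rewrite gt_eqF.
Qed.

End Pinning.

(** Both sides decompose as sums over pinnings of the complement of [N[v]]; on each feasible one,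
    [square_ge_of_gap] applies to the local law. *)
Lemma global_weighted_square_ge eta f : 0 <= eta < 1 ->
  (forall tau : config {u | u \in ~: cnbh e v} q, feasible mu tau ->
    spectral_gap_ge (weighted_lap (local_law mu tau) eta) ((1 - eta) / 2)) ->
  (1 - eta) / 2 * inner f (global_weighted_lap eta f) <=
  inner (global_weighted_lap eta f) (global_weighted_lap eta f).
Proof.
move=> /andP[eta_ge0 eta_lt1] gap; set M := global_weighted_lap eta.
have split_inner (g h : L2) : inner g h =
    \sum_(tau : config {u | u \in ~: cnbh e v} q)
    \sum_(x | restr (~: cnbh e v) x == tau) mu x * (ext g x * ext h x).
  by rewrite inner_ext // (partition_big (restr (~: cnbh e v)) predT).
rewrite !split_inner mulr_sumr; apply: ler_sum => tau _.
have : 0 <= Pr mu (pinned tau) by apply: sumr_ge0.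
rewrite le_eqVlt => /predU1P[/esym/eqP tau0|tau_gt0].
  move: tau0; rewrite psumr_eq0 // => /allP tau0.
  have tau0' x : restr (~: cnbh e v) x == tau -> mu x = 0.
    by move=> xtau; apply/eqP/(implyP (tau0 x (mem_index_enum x))).
  by rewrite !big1 ?mulr0 // => x /tau0' ->; rewrite mul0r.
(* A pinning of positive mass is induced by some configuration, which supplies the [z] of
   [overlay]. *)
have [z /eqP zE|no_z] := pickP (fun z => restr (~: cnbh e v) z == tau);
  last first.
  by move: tau_gt0; rewrite /Pr big_pred0 ?ltxx.
rewrite -zE in tau_gt0 *.
have feas : feasible mu (restr (~: cnbh e v) z) := tau_gt0.
rewrite -!inner_loc // mulrCA ler_wpM2l ?(ltW tau_gt0) //.
rewrite -!weighted_lap_loc //; apply: square_ge_of_gap; last exact: gap.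
- move=> g h; rewrite innerDMl innerDMr site_lap_sa lap_sa //.
- move=> g h; apply/ffunP => x; rewrite [LHS]ffunE site_lapB lapB !ffunE.
  ring.
- move=> c; apply/ffunP => x; rewrite [LHS]ffunE site_lap_cst lap_cst !ffunE.
  by rewrite mulr0 addr0.
- exact: local_law_distr.
- by rewrite divr_ge0 // subr_ge0 ltW.
Qed.

End Localization.

(** * Summing the local inequalities over a graph of girth at least five *)

Section QuadraticSum.
Variables (R : realType) (V : finType) (e : rel V).
Hypotheses (e_sym : symmetric e) (e_irr : irreflexive e).
Hypothesis girth_ge5 : (5%:E <= girth e R)%E.
Variable a : V -> V -> R.
Hypotheses (a_diag : forall u, 0 <= a u u)
  (a_far : forall u w, u != w -> ~~ e u w -> 0 <= a u w).

Definition nbh_pairs v : R :=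
  \sum_(u in nbh e v) \sum_(w in nbh e v | w != u) a u w.

Lemma nbh_pairs_ge0 v : 0 <= nbh_pairs v.
Proof.
apply: sumr_ge0 => u; rewrite inE => vu; apply: sumr_ge0 => w.
rewrite inE => /andP[vw wu]; apply: a_far; first by rewrite eq_sym.
exact: (no_triangle girth_ge5 e_sym e_irr vu vw).
Qed.

(* Each non-adjacent pair has at most one common neighbour, and each adjacent
   pair has none. *)
Lemma sum_nbh_pairs :
  \sum_v nbh_pairs v <= \sum_u \sum_(w | (w != u) && ~~ e u w) a u w.
Proof.
rewrite (exchange_big_dep predT) //=; apply: ler_sum => u _.
rewrite (exchange_big_dep (fun w => w != u)) /= => [|v w _ /andP[] //].
rewrite [X in _ <= X]big_mkcondr /=; apply: ler_sum => w wu.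
have [v /andP[vu vw]|no_v] := pickP (fun v => e v u && e v w).
  rewrite (no_triangle girth_ge5 e_sym e_irr vu vw) (big_pred1 v) // => v'.
  rewrite /= !inE wu andbT; apply/andP/eqP => [[v'u v'w]|->] //.
  apply: (common_nbh_uniq girth_ge5 e_sym e_irr _ v'u v'w vu vw).
  by rewrite eq_sym.
rewrite big_pred0 => [|v]; last by rewrite !inE wu andbT no_v.
by case: ifP => // euw; apply: a_far; rewrite ?euw // eq_sym.
Qed.

(** Here [a] stands for the Gram matrix of the functions [L_u f]; the last premise is the expanded
    local inequality [M_v ^ 2 >= (1 - eta_v) / 2 * M_v]. *)
Lemma quadratic_sum_ge (eta : V -> R) (eps : R) :
  (forall v, 0 <= eta v < 1) ->
  (forall v, \sum_(u in nbh e v) eta u <= 1 - eps) ->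
  (forall v, (1 - eta v) / 2 *
      (a v v + (1 + eta v) / 2 * \sum_(u in nbh e v) a u u) <=
    a v v + (1 + eta v) * (\sum_(u in nbh e v) a v u) +
    ((1 + eta v) / 2) ^+ 2 *
      \sum_(u in nbh e v) \sum_(w in nbh e v) a u w) ->
  eps / 2 * \sum_u a u u <= \sum_u \sum_w a u w.
Proof.
move=> eta_bound eta_sum local.
set D := \sum_u a u u; set Off := \sum_u \sum_(w | (w != u) && ~~ e u w) a u w.
pose Adj := \sum_v \sum_(u in nbh e v) a v u.
have -> : \sum_u \sum_w a u w = D + Adj + Off.
  rewrite -!big_split; apply: eq_bigr => u _ /=.
  rewrite (bigD1 u) //= (bigID (e u)) /= addrA; congr (_ + _ + _).
  apply: eq_bigl => w; rewrite inE andbC; case: (u =P w) => [<-|/eqP uw].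
    by rewrite e_irr.
  by rewrite eq_sym uw andbT.
have Off_ge0 : 0 <= Off.
  apply: sumr_ge0 => u _; apply: sumr_ge0 => w /andP[wu euw].
  by apply: a_far; rewrite // eq_sym.
(* The local inequality divided by [(1 + eta v) / 2]: the coefficients of [a v v] and of the
   neighbour sum become exactly 1 and [eta v], and [(1 + eta v) / 2 <= 1] simplifies that of
   [nbh_pairs v]. *)
have edge v : - a v v - eta v * \sum_(u in nbh e v) a u u - nbh_pairs v <=
    2 * \sum_(u in nbh e v) a v u.
  have /andP[eta_ge0 eta_lt1] := eta_bound v.
  have T_ge0 := nbh_pairs_ge0 v; move: (local v).
  have -> : \sum_(u in nbh e v) \sum_(w in nbh e v) a u w =
      \sum_(u in nbh e v) a u u + nbh_pairs v.
    by rewrite -big_split; apply: eq_bigr => u uv; rewrite (bigD1 u).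
  set d := \sum_(u in _) a u u; set S := \sum_(u in _) a v u.
  move: (a v v) (nbh_pairs v) (eta v) d S eta_ge0 eta_lt1 T_ge0.
  move=> b T t d S t_ge0 t_lt1 T_ge0 loc.
  have c_gt0 : 0 < (1 + t) / 2 by lra.
  have : 0 <= 2 * S + b + t * d + (1 + t) / 2 * T.
    by rewrite -(pmulr_rge0 _ c_gt0); move: loc; rewrite -subr_ge0;
      congr (0 <= _); field.
  have : (1 + t) / 2 * T <= T by rewrite ler_piMl //; lra.
  lra.
(* Double counting: [a u u] is collected once from each neighbour [v] of [u], with total weight at
   most [1 - eps]. *)
have eta_D : \sum_v eta v * \sum_(u in nbh e v) a u u <= (1 - eps) * D.
  under eq_bigr do rewrite mulr_sumr.
  rewrite (exchange_big_dep predT) //= mulr_sumr; apply: ler_sum => u _.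
  rewrite -mulr_suml ler_wpM2r //; apply: le_trans (eta_sum u).
  rewrite le_eqVlt (eq_bigl (mem (nbh e u))) ?eqxx // => v.
  by rewrite !inE e_sym.
(* Summed over [v], with [eta_D] and [sum_nbh_pairs], the edge bounds give
   [2 * Adj >= - (2 - eps) * D - Off]; hence [D + Adj + Off] is at least [eps / 2 * D + Off / 2]. *)
have := ler_sum (index_enum V) (fun v (_ : predT v) => edge v).
rewrite -mulr_sumr -/Adj !sumrB sumrN -/D => edges.
have := sum_nbh_pairs; rewrite -/Off.
lra.
Qed.

End QuadraticSum.

(** * The global gap from the Gram matrix of the functions [L_u f] *)

Theorem theorem20 (R : realType) (V : finType) (e : rel V)
  (e_sym : symmetric e) (e_irr : irreflexive e)
  (girth_ge5 : (5%:E <= girth e R)%E)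
  (q : nat) (q_gt0 : (0 < q)%N)
  (mu : config V q -> R) (mu_distr : is_distr mu)
  (mu_ci : cond_indep e mu) (mu_irr : irreducible mu)
  (eta : V -> R) (eta_bound : forall v, 0 <= eta v < 1)
  (local_gap : forall (v : V) (tau : config {u | u \in ~: cnbh e v} q),
     feasible mu tau ->
     spectral_gap_ge (weighted_lap (local_law mu tau) (eta v))
       ((1 - eta v) / 2))
  (eps : R) (eps_gt0 : 0 < eps)
  (eta_sum : forall v, \sum_(u in nbh e v) eta u <= 1 - eps) :
  spectral_gap_ge (glauber_lap mu) (eps / 2).
Proof.
have [mu_ge0 _] := mu_distr.
apply: gap_of_square_ge => // [|f]; first by rewrite divr_ge0 ?ltW.
pose a u w := inner (site_lap u f) (site_lap w f).
have diag u : inner f (site_lap u f) = a u u.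
  by rewrite /a site_lap_sa site_lapK.
have sumT (F : V -> R) : \sum_(u in [set: V]) F u = \sum_u F u.
  by apply: eq_bigl => u; rewrite inE.
rewrite {1}/glauber_lap /lap inner_sumr sumT (eq_bigr _ (fun u _ => diag u)).
have -> : inner (glauber_lap mu f) (glauber_lap mu f) = \sum_u \sum_w a u w.
  rewrite inner_suml sumT; apply: eq_bigr => u _.
  by rewrite inner_sumr sumT.
apply: (quadratic_sum_ge e_sym e_irr girth_ge5 _ _ eta_bound eta_sum).
- by move=> u; apply: inner_ge0.
- move=> u w uw euw; apply: inner_site_lap_comm_ge0.
  apply: heat_bath_comm => //.
  by apply: (cond_indep_fiber_product mu_ge0 mu_ci).
move=> v.
have := global_weighted_square_ge mu_ge0 f (eta_bound v) (@local_gap v).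
rewrite !(innerDMl, innerDMr) diag !(inner_suml, inner_sumr).
rewrite (eq_bigr _ (fun u _ => diag u)).
(* The two cross terms agree by symmetry, which doubles [(1 + eta v) / 2]. *)
rewrite [X in _ + _ * (X + _)](_ : _ = \sum_(u in nbh e v) a v u); last first.
  by apply: eq_bigr => u _; rewrite innerC.
rewrite [X in _ + _ * (_ + _ * X)](_ : _ =
  \sum_(u in nbh e v) \sum_(w in nbh e v) a u w); last first.
  by apply: eq_bigr => u _; rewrite inner_sumr.
move/le_trans; apply; rewrite -/(a v v) le_eqVlt; apply/orP; left; apply/eqP.
by rewrite -[\sum_(i in _) inner (site_lap v f) _]/(\sum_(u in nbh e v) a v u);
  field.
Qed.
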